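(* Two words $w_1$ and $w_2$ over $\mathcal{G}$ (vertices of $\Gamma$) belong to the same connected component of $\Gamma$ if and only if $Q(w_1)=Q(w_2)$.
   Context: Let $\mathcal{G}=\{1,2,3,0,\bar3,\bar2,\bar1\}$, totally ordered by $1\prec2\prec3\prec0\prec\bar3\prec\bar2\prec\bar1$. $B(\Lambda_1)$ is the $U_q(G_2)$-crystal with vertices $\mathcal{G}$ and arrows $1\xrightarrow{1}2\xrightarrow{2}3\xrightarrow{1}0\xrightarrow{1}\bar3\xrightarrow{2}\bar2\xrightarrow{1}\bar1$ ($a\xrightarrow{i}b$ means $\tilde f_ia=b$, $\tilde e_ib=a$; other applications give $0$); $\varepsilon_i(u)=\max\{k:\tilde e_i^ku\ne0\}$, $\varphi_i(u)=\max\{k:\tilde f_i^ku\ne0\}$. Words over $\mathcal{G}$ are identified with vertices of the crystal $\Gamma=\bigoplus_{l\ge0}B(\Lambda_1)^{\otimes l}$, with $\tilde f_i(u\otimes v)=\tilde f_iu\otimes v$ if $\varphi_i(u)>\varepsilon_i(v)$, else $u\otimes\tilde f_iv$; $\tilde e_i(u\otimes v)=u\otimes\tilde e_iv$ if $\varphi_i(u)<\varepsilon_i(v)$, else $\tilde e_iu\otimes v$. $B(w)$ is the connected component containing $w$; $w_1\sim w_2$ means there is a crystal isomorphism $B(w_1)\to B(w_2)$ sending $w_1$ to $w_2$. Tableaux of type $G_2$: $\mathrm{dist}(a,b)$ is the number of arrows between $a$ and $b$ in the chain above. A column is a box $[a]$ or two boxes with top $a$, bottom $b$, $a\prec b$ or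 $a=b=0$; reading $\mathrm{w}(C)$ top to bottom. Height-1 columns are admissible; a height-2 column $(a,b)$ is admissible if $\mathrm{dist}(a,b)\le2$ for $a\in\{1,0\}$ and $\le3$ otherwise. For admissible columns, $C_1\preceq C_2$ means: (i) $[a],[b]$ with $a\preceq b$, $(a,b)\ne(0,0)$; or (ii) $C_1=(a,b)$, $C_2=[c]$ with $a\preceq c$, $(a,c)\ne(0,0)$; or (iii) $C_1=(a,b)$, $C_2=(c,d)$ with $a\preceq c$, $(a,c)\neq(0,0)$, $b\preceq d$, $(b,d)\ne(0,0)$, and $\mathrm{dist}(a,d)\ge3$ if $a\in\{2,3,0\}$, $\mathrm{dist}(a,d)\ge2$ if $a=\bar3$. For $\lambda=\lambda_1\Lambda_1+\lambda_2\Lambda_2$, $Y(\lambda)$ has $\lambda_2$ columns of height 2 followed by $\lambda_1$ columns of height 1; a tableau of type $G_2$ of shape $\lambda$ is a filling $T=C_1\cdots C_s$ of $Y(\lambda)$ with admissible columns and $C_i\preceq C_{i+1}$; reading $\mathrm{w}(T)=\mathrm{w}(C_s)\cdots\mathrm{w}(C_1)$; its shape is $Y(\lambda)$. By Kang–Misra, for every word $w$ there is a unique tableau of type $G_2$, $P(w)$, with $w\sim\mathrm{w}(P(w))$. For a word $w=x_1\cdots x_l$, $Q(w)=(Q_1,\dots,Q_l)$ where $Q_i$ is the shape of $P(x_1\cdots x_i)$. *)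

(* Defs.v *)
(* MathComp; classical choice (Stdlib's [epsilon]) is used only to name [P w]. *)
From HB Require Import structures.
From mathcomp Require Import all_boot.
From Stdlib Require Import Relation_Operators ClassicalEpsilon.

Set Implicit Arguments.
Unset Strict Implicit.
Unset Printing Implicit Defensive.

(* The suffix b stands for an overbar. *)
Inductive letter := L1 | L2 | L3 | L0 | L3b | L2b | L1b.

(* Position in the chain 1 < 2 < 3 < 0 < 3b < 2b < 1b. *)
Definition rank (a : letter) : nat :=
  match a with
  | L1 => 0 | L2 => 1 | L3 => 2 | L0 => 3 | L3b => 4 | L2b => 5 | L1b => 6
  end.

Lemma rank_inj : injective rank.
Proof. by do 2!case. Qed.

HB.instance Definition _ := Equality.copy letter (inj_type rank_inj).

Definition leL (a b : letter) : bool := rank a <= rank b.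
Definition ltL (a b : letter) : bool := rank a < rank b.

(* One of the two truncated differences vanishes. *)
Definition dist (a b : letter) : nat := (rank a - rank b) + (rank b - rank a).

Inductive color := c1 | c2.

(* Crystal operators are partial functions; [None] is the 0 of the crystal. *)
Definition f1 (i : color) (a : letter) : option letter :=
  match i, a with
  | c1, L1 => Some L2
  | c2, L2 => Some L3
  | c1, L3 => Some L0
  | c1, L0 => Some L3b
  | c2, L3b => Some L2b
  | c1, L2b => Some L1b
  | _, _ => None
  end.

Definition e1 (i : color) (b : letter) : option letter :=
  match i, b with
  | c1, L2 => Some L1
  | c2, L3 => Some L2
  | c1, L0 => Some L3
  | c1, L3b => Some L0
  | c2, L2b => Some L3b
  | c1, L1b => Some L2b
  | _, _ => None
  end.

Definition word := seq letter.

Definition opow (T : Type) (g : T -> option T) (k : nat) (u : T) : option T :=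
  iter k (obind g) (Some u).

(* max {k <= n | g^k u <> 0}. Below n is always large enough for this to be the
   unrestricted maximum (see [leq_phi1], [leq_eps] and [leq_phi]). *)
Fixpoint string_length (T : Type) (g : T -> option T) (n : nat) (u : T) : nat :=
  if n is n'.+1 then
    if g u is Some u' then (string_length g n' u').+1 else 0
  else 0.

Definition phi1 (i : color) (a : letter) : nat := string_length (f1 i) 6 a.

(* A crystal arrow moves one letter of a word one step along the chain, which has
   6 arrows. *)
Definition max_string (w : word) : nat := 6 * size w.

(* [x :: v] is the tensor product of x and v. [e_level i n] is the operator on
   words of length n; the tensor rule needs the whole operator on words of length
   n - 1, hence the recursion on n. *)
Fixpoint e_level (i : color) (n : nat) (w : word) : option word :=
  match n, w with
  | n'.+1, x :: v =>
      if phi1 i x < string_length (e_level i n') (max_string v) v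
      then omap (cons x) (e_level i n' v)
      else omap (cons^~ v) (e1 i x)
  | _, _ => None
  end.

Definition e (i : color) (w : word) : option word := e_level i (size w) w.

Definition eps (i : color) (w : word) : nat :=
  string_length (e i) (max_string w) w.

Fixpoint f (i : color) (w : word) : option word :=
  if w is x :: v then
    if eps i v < phi1 i x
    then omap (cons^~ v) (f1 i x)
    else omap (cons x) (f i v)
  else None.

Definition phi (i : color) (w : word) : nat :=
  string_length (f i) (max_string w) w.

Lemma opowS (T : Type) (g : T -> option T) (k : nat) (u : T) : opow g k.+1 u = obind (opow g k) (g u).
Proof.
rewrite /opow iterSr /=; case: (g u) => //=.
by elim: k => //= k ->.
Qed.

Lemma leq_string_length (T : Type) (g : T -> option T) (m : T -> nat) (n : nat) (u : T) :
    (forall v v', g v = Some v' -> m v' < m v) -> m u <= n ->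
  forall k, (k <= string_length g n u) = (opow g k u : bool).
Proof.
move=> gm; elim: n u => [|n IHn] u mu [|k] //; rewrite opowS /=;
  case gu: (g u) => [u'|] //=.
  by have := leq_trans (gm _ _ gu) mu.
by rewrite ltnS IHn // -ltnS (leq_trans (gm _ _ gu)).
Qed.

Lemma eq_string_length (T : Type) (g h : T -> option T) (D : T -> Prop) n u :
    (forall v, D v -> g v = h v) -> (forall v v', D v -> h v = Some v' -> D v') ->
  D u -> string_length g n u = string_length h n u.
Proof.
move=> gh hD; elim: n u => //= n IHn u Du; rewrite gh //.
by case hu: (h u) => [u'|] //; rewrite IHn //; apply: hD hu.
Qed.

Lemma e_level_size i n w w' : e_level i n w = Some w' -> size w' = size w.
Proof.
elim: n w w' => [|n IHn] [|x v] w' //=; case: ifP => _.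
  by case ev: e_level => [v'|] //= [<-] /=; rewrite (IHn _ _ ev).
by case: (e1 i x) => //= y [<-].
Qed.

Lemma e_cons i x v :
  e i (x :: v) = if phi1 i x < eps i v then omap (cons x) (e i v)
                 else omap (cons^~ v) (e1 i x).
Proof.
rewrite /e /= -/(e i v); congr (if _ < _ then _ else _).
apply: (@eq_string_length _ _ _ (fun u => size u = size v)) => //.
  by move=> u su; rewrite /e su.
by move=> u u' <- /e_level_size.
Qed.

Lemma f_cons i x v :
  f i (x :: v) = if eps i v < phi1 i x then omap (cons^~ v) (f1 i x)
                 else omap (cons x) (f i v).
Proof. by []. Qed.

Definition total_rank (w : word) : nat := sumn (map rank w).

Lemma total_rank_max w : total_rank w <= max_string w.
Proof.
rewrite /total_rank /max_string.
by elim: w => //= x w IHw; rewrite mulnS leq_add //; case: x.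
Qed.

Lemma e_total_rank i w w' : e i w = Some w' -> total_rank w = (total_rank w').+1.
Proof.
elim: w w' => [|x v IHv] w' //; rewrite e_cons; case: ifP => _.
  case ev: (e i v) => [v'|] //= [<-].
  by rewrite /total_rank /= -/(total_rank v) (IHv _ ev) addnS.
by case: i {IHv} => //; case: x => //= -[<-]; rewrite /total_rank /=.
Qed.

Lemma f_total_rank i w w' : f i w = Some w' -> total_rank w' = (total_rank w).+1.
Proof.
elim: w w' => [|x v IHv] w' //; rewrite f_cons; case: ifP => _.
  by case: i {IHv} => //; case: x => //= -[<-]; rewrite /total_rank /=.
case ev: (f i v) => [v'|] //= [<-].
by rewrite /total_rank /= -/(total_rank v') (IHv _ ev) addnS.
Qed.

Lemma f_size i w w' : f i w = Some w' -> size w' = size w.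
Proof.
elim: w w' => [|x v IHv] w' //; rewrite f_cons; case: ifP => _.
  by case: (f1 i x) => //= y [<-].
by case fv: (f i v) => [v'|] //= [<-] /=; rewrite (IHv _ fv).
Qed.

Lemma leq_phi1 i x k : (k <= phi1 i x) = (opow (f1 i) k x : bool).
Proof.
apply: (@leq_string_length _ _ (fun a => 6 - rank a)); last exact: leq_subr.
by case: i; case=> // v' [<-].
Qed.

Lemma leq_eps i w k : (k <= eps i w) = (opow (e i) k w : bool).
Proof.
apply: (@leq_string_length _ _ total_rank); last exact: total_rank_max.
by move=> v v' /e_total_rank ->.
Qed.

Lemma leq_phi i w k : (k <= phi i w) = (opow (f i) k w : bool).
Proof.
apply: (@leq_string_length _ _ (fun u => max_string u - total_rank u)).
  move=> v v' fv; have sv := f_size fv; have rv := f_total_rank fv.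
  have := total_rank_max v'; rewrite rv /max_string sv => lt_v.
  by rewrite ltn_sub2l.
exact: leq_subr.
Qed.

Definition arrow (u v : word) : Prop := exists i, f i u = Some v.

Definition same_component : word -> word -> Prop := clos_refl_sym_trans word arrow.

(* B(w), as a set of words. *)
Definition B (w : word) (u : word) : Prop := same_component w u.

(* [omap psi] sends 0 to 0. *)
Definition crystal_iso (w1 w2 : word) (psi : word -> word) : Prop :=
  [/\ forall u, B w1 u -> B w2 (psi u),
      forall u v, B w1 u -> B w1 v -> psi u = psi v -> u = v,
      forall v, B w2 v -> exists2 u, B w1 u & psi u = v
    & forall i u, B w1 u ->
        e i (psi u) = omap psi (e i u) /\ f i (psi u) = omap psi (f i u)].

Definition crystal_eq (w1 w2 : word) : Prop :=
  exists2 psi, crystal_iso w1 w2 psi & psi w1 = w2.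

(* [Box2 a b] has top a and bottom b. *)
Inductive column := Box1 of letter | Box2 of letter & letter.

Definition height (C : column) : nat := if C is Box2 _ _ then 2 else 1.

Definition read_column (C : column) : word :=
  match C with Box1 a => [:: a] | Box2 a b => [:: a; b] end.

Definition is_column (C : column) : bool :=
  match C with
  | Box1 _ => true
  | Box2 a b => ltL a b || (a == L0) && (b == L0)
  end.

Definition admissible (C : column) : bool :=
  is_column C &&
  match C with
  | Box1 _ => true
  | Box2 a b => dist a b <= (if a \in [:: L1; L0] then 2 else 3)
  end.

Definition row_le (a b : letter) : bool := leL a b && ((a, b) != (L0, L0)).

Definition leC (C D : column) : bool :=
  match C, D with
  | Box1 a, Box1 b => row_le a b
  | Box2 a _, Box1 c => row_le a c
  | Box2 a b, Box2 c d =>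
      [&& row_le a c, row_le b d,
          (a \in [:: L2; L3; L0]) ==> (3 <= dist a d)
        & (a == L3b) ==> (2 <= dist a d)]
  | Box1 _, Box2 _ _ => false
  end.

(* Y(l1 Lambda_1 + l2 Lambda_2), given by its column heights from left to right. *)
Definition Y (l1 l2 : nat) : seq nat := nseq l2 2 ++ nseq l1 1.

Definition shape (T : seq column) : seq nat := map height T.

Definition tableau_of (l1 l2 : nat) (T : seq column) : Prop :=
  [/\ shape T = Y l1 l2, all admissible T & sorted leC T].

Definition is_tableau (T : seq column) : Prop :=
  exists l1 l2, tableau_of l1 l2 T.

Definition reading (T : seq column) : word := flatten (map read_column (rev T)).

(* The tableau T with w ~ w(T). Its existence and uniqueness (Kang-Misra) are not
   needed to write it down: [epsilon] picks such a T whenever there is one. *)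
Definition P (w : word) : seq column :=
  epsilon (inhabits [::]) (fun T => is_tableau T /\ crystal_eq w (reading T)).

Definition Q (w : word) : seq (seq nat) :=
  [seq shape (P (take i w)) | i <- iota 1 (size w)].

(* Main.v *)
(* The relation [w1 ~ w2] is a congruence for concatenation. In this tensor
   convention every prefix of a highest weight word is one, so a highest weight
   word can be rewritten letter by letter to [1^a (12)^b], of weight
   [a Lambda_1 + b Lambda_2], using only
     121 ~ 112,  123 ~ 11,  10 ~ 1,  11(3b) ~ 12,  12(2b) ~ 1,  1(1b) ~ empty,
   each a statement about two finite crystals. The readings of the tableaux of a
   given shape are closed under the crystal operators because, by the signature
   rule, an operator that changes one column is constrained by its two neighbours
   only; [1^a (12)^b] is the only highest weight word among the readings of shape
   [Y a b]. Hence every component has a unique highest weight word, whose weight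
   is the shape of [P w] for all [w] in it. Finally, [Q w] determines the
   successive weights of the prefixes of that highest weight word, hence its
   letters, because the seven letters have distinct weights. *)
From mathcomp Require Import all_boot zify.
From Stdlib Require Import Relation_Operators ClassicalEpsilon.
Require Import Defs.

Set Implicit Arguments.
Unset Strict Implicit.
Unset Printing Implicit Defensive.

(** * String lengths and the tensor product rule on concatenations *)

Definition eps1 (i : color) (a : letter) : nat := string_length (e1 i) 6 a.

Lemma e1_f1 i a b : e1 i b = Some a <-> f1 i a = Some b.
Proof. by case: i; case: a; case: b. Qed.

Lemma e1_strings i a b :
  e1 i b = Some a -> eps1 i b = (eps1 i a).+1 /\ phi1 i a = (phi1 i b).+1.
Proof. by case: i; case: a; case: b. Qed.

Lemma e1_None i a : e1 i a = None <-> eps1 i a = 0.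
Proof. by case: i; case: a. Qed.

Lemma f1_None i a : f1 i a = None <-> phi1 i a = 0.
Proof. by case: i; case: a. Qed.

(** The hypothesis makes [h v] the largest exponent of a nonzero power of [g], so the bound built
    into [string_length] can be forgotten from here on. *)
Lemma string_rec (T : Type) (g : T -> option T) (h : T -> nat) u :
  (forall v k, (k <= h v) = (opow g k v : bool)) ->
  h u = if g u is Some u' then (h u').+1 else 0.
Proof.
move=> hP; case gu: (g u) => [v|]; last first.
  by apply/eqP; rewrite -leqn0 leqNgt hP opowS gu.
have vu k : (k.+1 <= h u) = (k <= h v) by rewrite !hP opowS gu.
apply/eqP; rewrite eqn_leq vu leqnn andbT.
by case hu: (h u) => [//|k]; rewrite ltnS -vu hu.
Qed.

Lemma eps_rec i u : eps i u = if e i u is Some u' then (eps i u').+1 else 0.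
Proof. by apply: string_rec => v k; exact: leq_eps. Qed.

Lemma phi_rec i u : phi i u = if f i u is Some u' then (phi i u').+1 else 0.
Proof. by apply: string_rec => v k; exact: leq_phi. Qed.

Lemma e_None i u : e i u = None <-> eps i u = 0.
Proof. by rewrite eps_rec; case: (e i u). Qed.

Lemma f_None i u : f i u = None <-> phi i u = 0.
Proof. by rewrite phi_rec; case: (f i u). Qed.

(** [e] selects the factor that [f] changed: acting on the head leaves its [phi1] at least the [eps]
    of the tail, while acting on the tail raises that [eps] above the [phi1] of the head. *)
Lemma f_e i u v : f i u = Some v -> e i v = Some u.
Proof.
elim: u v => [|x t IHt] v //; rewrite f_cons; case: ltnP => tx.
  case fx: (f1 i x) => [y|] //= [<-]; rewrite e_cons.
  have /e1_f1 ey := fx; have [_ xy] := e1_strings ey.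
  by rewrite ltnNge -ltnS -xy tx /= ey.
case ft: (f i t) => [t'|] //= [<-]; rewrite e_cons.
have et := IHt _ ft.
by rewrite (eps_rec i t') et ltnS tx.
Qed.

Lemma e_f i u v : e i v = Some u -> f i u = Some v.
Proof.
elim: v u => [|x t IHt] u //; rewrite e_cons; case: ltnP => tx.
  case et: (e i t) => [t'|] //= [<-]; rewrite f_cons.
  move: tx; rewrite (eps_rec i t) et ltnS => tx.
  by rewrite ltnNge tx /= (IHt _ et).
case ex: (e1 i x) => [y|] //= [<-]; rewrite f_cons.
have [_ xy] := e1_strings ex; have /e1_f1 fy := ex.
by rewrite xy ltnS tx /= fy.
Qed.

(** This is the signature rule, with truncated subtraction as the maximum with 0. The induction is
    on the rank, which [e] lowers. *)
Lemma eps_cons i x v : eps i (x :: v) = eps1 i x + (eps i v - phi1 i x).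
Proof.
have [n] := ubnP (total_rank (x :: v)); elim: n => // n IHn in x v *.
move=> rk; rewrite eps_rec; case ev: (e i (x :: v)) => [w|]; move: (ev); rewrite e_cons.
  have := e_total_rank ev; move: rk => /[swap] -> /[!ltnS] rk.
  case: ltnP => xv.
    case ev': (e i v) => [v'|] //= [wE]; rewrite -wE in rk *.
    rewrite (IHn _ _ rk) (eps_rec i v) ev' -addnS subSn // .
    by move: xv; rewrite (eps_rec i v) ev'.
  case ex: (e1 i x) => [y|] //= [wE]; rewrite -wE in rk *.
  rewrite (IHn _ _ rk); have [-> ->] := e1_strings ex; lia.
case: ltnP => xv.
  by case ev': (e i v) => [//|]; move: xv; rewrite (eps_rec i v) ev'.
case ex: (e1 i x) => [//|] _; move/e1_None: ex => ->; lia.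
Qed.

Lemma phi_cons i x v : phi i (x :: v) = phi i v + (phi1 i x - eps i v).
Proof.
have [n] := ubnP (max_string (x :: v) - total_rank (x :: v)); elim: n => // n IHn in x v *.
move=> rk; rewrite phi_rec; case fv: (f i (x :: v)) => [w|]; move: (fv); rewrite f_cons.
  have {}rk : max_string w - total_rank w < n.
    have := total_rank_max w; rewrite (f_total_rank fv) /max_string (f_size fv).
    by move: rk; rewrite /max_string; lia.
  case: ltnP => xv.
    case fx: (f1 i x) => [y|] //= [wE]; rewrite -wE in rk *; rewrite (IHn _ _ rk).
    by have /e1_f1 /e1_strings [_ xy] := fx; lia.
  case fv': (f i v) => [v'|] //= [wE]; rewrite -wE in rk *; rewrite (IHn _ _ rk).
  by rewrite (phi_rec i v) fv' (eps_rec i v') (f_e fv'); lia.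
case: ltnP => xv.
  by case fx: (f1 i x) => [//|]; move/f1_None: fx; lia.
case fv': (f i v) => [//|] _; move/f_None: fv' => ->; lia.
Qed.

Lemma eps_phi_cat i u v :
  eps i (u ++ v) = eps i u + (eps i v - phi i u) /\
  phi i (u ++ v) = phi i v + (phi i u - eps i v).
Proof.
elim: u => [|x u [IHe IHp]] /=.
  have -> : eps i [::] = 0 by [].
  have -> : phi i [::] = 0 by [].
  lia.
by rewrite !eps_cons !phi_cons IHe IHp; lia.
Qed.

Lemma eps_cat i u v : eps i (u ++ v) = eps i u + (eps i v - phi i u).
Proof. by case: (eps_phi_cat i u v). Qed.

Lemma phi_cat i u v : phi i (u ++ v) = phi i v + (phi i u - eps i v).
Proof. by case: (eps_phi_cat i u v). Qed.

Lemma f_cat i u v :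
  f i (u ++ v) = if eps i v < phi i u then omap (cat^~ v) (f i u)
                 else omap (cat u) (f i v).
Proof.
elim: u => [|x u IHu]; first by rewrite /=; case: (f i v).
rewrite cat_cons !f_cons IHu eps_cat phi_cons.
by (do !case: ltnP => ?); try lia; case: (f i v) => //; case: (f i u) => //;
  case: (f1 i x).
Qed.

Lemma e_cat i u v :
  e i (u ++ v) = if phi i u < eps i v then omap (cat u) (e i v)
                 else omap (cat^~ v) (e i u).
Proof.
elim: u => [|x u IHu]; first by rewrite /= (eps_rec i v); case: (e i v).
rewrite cat_cons !e_cons IHu eps_cat phi_cons.
by (do !case: ltnP => ?); try lia; case: (e i v) => //; case: (e i u) => //;
  case: (e1 i x).
Qed.

(** * Partial isomorphisms and their congruence under concatenation *)

Definition opt_rel (R : word -> word -> Prop) (o o' : option word) : Prop :=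
  match o, o' with
  | Some u, Some v => R u v
  | None, None => True
  | _, _ => False
  end.

(* A partial bijection between words of fixed lengths which is compatible with
   the crystal operators; the lengths make the pieces of a concatenation
   recoverable in [crystal_corr_cat]. *)
Record crystal_corr (m n : nat) (R : word -> word -> Prop) : Prop := CrystalCorr {
  corr_size : forall u v, R u v -> size u = m /\ size v = n;
  corr_fun : forall u v v', R u v -> R u v' -> v = v';
  corr_inj : forall u u' v, R u v -> R u' v -> u = u';
  corr_e : forall i u v, R u v -> opt_rel R (e i u) (e i v);
  corr_f : forall i u v, R u v -> opt_rel R (f i u) (f i v)
}.

(** The domain of [R] may be any union of components, which allows gluing factor by factor;
    [crystal_eqE] recovers isomorphisms of components. *)
Definition sim (u v : word) : Prop :=
  exists m n R, crystal_corr m n R /\ R u v.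

Lemma corr_eps m n R i u v : crystal_corr m n R -> R u v -> eps i u = eps i v.
Proof.
move=> cR; have [k] := ubnP (total_rank u); elim: k => // k IHk in u v *.
move=> uk Ruv; rewrite eps_rec (eps_rec i v).
have := corr_e cR i Ruv; case eu: (e i u) => [u'|]; case: (e i v) => [v'|] //= Ruv'.
by rewrite (IHk _ v') // -ltnS -(e_total_rank eu).
Qed.

Lemma corr_phi m n R i u v : crystal_corr m n R -> R u v -> phi i u = phi i v.
Proof.
move=> cR; have [k] := ubnP (6 * m - total_rank u); elim: k => // k IHk in u v *.
move=> uk Ruv; rewrite phi_rec (phi_rec i v).
have := corr_f cR i Ruv; case fu: (f i u) => [u'|]; case: (f i v) => [v'|] //= Ruv'.
rewrite (IHk _ v') //; have [su' _] := corr_size cR Ruv'.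
by have := total_rank_max u'; rewrite /max_string su' (f_total_rank fu); lia.
Qed.

Lemma sim_phi i u v : sim u v -> phi i u = phi i v.
Proof. by case=> m [n [R [cR Ruv]]]; exact: corr_phi cR Ruv. Qed.

Lemma sim_eps i u v : sim u v -> eps i u = eps i v.
Proof. by case=> m [n [R [cR Ruv]]]; exact: corr_eps cR Ruv. Qed.

Lemma e_size i u v : e i u = Some v -> size v = size u.
Proof. by move/e_f/f_size. Qed.

Lemma sim_refl u : sim u u.
Proof.
exists (size u), (size u), (fun v w => v = w /\ size v = size u); split=> //; split.
- by move=> v w [<-].
- by move=> v w w' [<- _] [<-].
- by move=> v v' w [-> _] [->].
- by move=> i v w [<- sv]; case ev: (e i v) => [v'|] //=; rewrite (e_size ev).
- by move=> i v w [<- sv]; case fv: (f i v) => [v'|] //=; rewrite (f_size fv).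
Qed.

Lemma opt_rel_sym R o o' : opt_rel R o o' -> opt_rel (fun v u => R u v) o' o.
Proof. by case: o; case: o'. Qed.

Lemma corr_sym m n R :
  crystal_corr m n R -> crystal_corr n m (fun v u => R u v).
Proof.
case=> sR fR iR eR gR; split.
- by move=> v u /sR [].
- by move=> w v1 v2 h1 h2; exact: iR h1 h2.
- by move=> w v1 v2 h1 h2; exact: fR h1 h2.
- by move=> i v u R'; exact/opt_rel_sym/eR.
- by move=> i v u R'; exact/opt_rel_sym/gR.
Qed.

Lemma sim_sym u v : sim u v -> sim v u.
Proof.
by case=> m [n [R [/corr_sym cR Ruv]]]; exists n, m, (fun v u => R u v).
Qed.

Lemma sim_trans v u w : sim u v -> sim v w -> sim u w.
Proof.
case=> m [n [R [[sR fR iR eR gR] Ruv]]] [m' [n' [S [[sS fS iS eS gS] Svw]]]].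
exists m, n', (fun u w => exists2 v, R u v & S v w); split; last by exists v.
split.
- by move=> u' w' [v' /sR [? _] /sS [_ ?]].
- by move=> u' w' w'' [v' Rv' Sv'] [v'' /(fR _ _ _ Rv') <-]; exact: fS.
- by move=> u' u'' w' [v' Rv' Sv'] [v'' + /(iS _ _ _ Sv') E]; rewrite -E; exact: iR.
- move=> i u' w' [v' /(eR i) Rv' /(eS i)]; move: Rv'.
  by case: (e i u') => [u''|]; case: (e i v') => [v''|]; case: (e i w') => [w''|] //=; exists v''.
- move=> i u' w' [v' /(gR i) Rv' /(gS i)]; move: Rv'.
  by case: (f i u') => [u''|]; case: (f i v') => [v''|]; case: (f i w') => [w''|] //=; exists v''.
Qed.

(** The tensor rule consults only [phi] of the left factor and [eps] of the right one, and
    correspondences preserve both. *)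
Lemma sim_cat u v u' v' : sim u v -> sim u' v' -> sim (u ++ u') (v ++ v').
Proof.
case=> m [n [R [cR Ruv]]] [m' [n' [S [cS Suv]]]].
pose RS w z := exists w1 w2 z1 z2, [/\ w = w1 ++ w2, z = z1 ++ z2, R w1 z1 & S w2 z2].
exists (m + m'), (n + n'), RS; split; last by exists u, u', v, v'.
split.
- move=> _ _ [w1 [w2 [z1 [z2 [-> -> /(corr_size cR) [s1 s1'] /(corr_size cS) [s2 s2']]]]]].
  by rewrite !size_cat s1 s1' s2 s2'.
- move=> _ _ _ [w1 [w2 [z1 [z2 [-> -> R1 S1]]]]] [w1' [w2' [z1' [z2' [/eqP + -> R2 S2]]]]].
  (* All left factors have length [m], so equal concatenations have equal factors. *)
  have [sw _] := corr_size cR R1; have [sw' _] := corr_size cR R2.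
  rewrite eqseq_cat ?sw // => /andP [/eqP E1 /eqP E2]; subst w1' w2'.
  by rewrite (corr_fun cR R1 R2) (corr_fun cS S1 S2).
- move=> _ _ _ [w1 [w2 [z1 [z2 [-> -> R1 S1]]]]] [w1' [w2' [z1' [z2' [-> /eqP + R2 S2]]]]].
  have [_ sw] := corr_size cR R1; have [_ sw'] := corr_size cR R2.
  rewrite eqseq_cat ?sw // => /andP [/eqP E1 /eqP E2]; subst z1' z2'.
  by rewrite (corr_inj cR R1 R2) (corr_inj cS S1 S2).
- move=> i _ _ [w1 [w2 [z1 [z2 [-> -> R1 S1]]]]].
  rewrite !e_cat (corr_phi i cR R1) (corr_eps i cS S1).
  case: ifP => _.
    have := corr_e cS i S1; case: (e i w2) => [w2'|]; case: (e i z2) => [z2'|] //= S2.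
    by exists w1, w2', z1, z2'.
  have := corr_e cR i R1; case: (e i w1) => [w1'|]; case: (e i z1) => [z1'|] //= R2.
  by exists w1', w2, z1', z2.
- move=> i _ _ [w1 [w2 [z1 [z2 [-> -> R1 S1]]]]].
  rewrite !f_cat (corr_phi i cR R1) (corr_eps i cS S1).
  case: ifP => _; last first.
    have := corr_f cS i S1; case: (f i w2) => [w2'|]; case: (f i z2) => [z2'|] //= S2.
    by exists w1, w2', z1, z2'.
  have := corr_f cR i R1; case: (f i w1) => [w1'|]; case: (f i z1) => [z1'|] //= R2.
  by exists w1', w2, z1', z2.
Qed.

(** * Connected components and crystal isomorphisms *)

Lemma component_invariant (D : word -> Prop) u v :
    (forall i w w', f i w = Some w' -> D w <-> D w') ->
  same_component u v -> D u <-> D v.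
Proof.
move=> Df; elim=> [w w' [i /Df]||w w' _ IH|w w' w'' _ IH _ IH'] //.
  by split; apply IH.
by split=> [/IH/IH'|/IH'/IH].
Qed.

Lemma component_refl u : same_component u u.
Proof. exact: rst_refl. Qed.

Lemma component_sym u v : same_component u v -> same_component v u.
Proof. exact: rst_sym. Qed.

Lemma component_trans u v w : same_component u v -> same_component v w -> same_component u w.
Proof. exact: rst_trans. Qed.

Lemma component_f i u v : f i u = Some v -> same_component u v.
Proof. by move=> fu; apply: rst_step; exists i. Qed.

Lemma component_e i u v : e i u = Some v -> same_component u v.
Proof. by move/e_f/component_f/component_sym. Qed.

Lemma component_size u v : same_component u v -> size u = size v.
Proof.
move=> uv; apply/esym.
apply: (proj1 (component_invariant (D := fun w => size w = size u) _ uv)) => //.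
by move=> i w w' /f_size ->.
Qed.

Lemma corr_component m n R u v u' :
    crystal_corr m n R -> R u v -> same_component u u' ->
  exists2 v', R u' v' & same_component v v'.
Proof.
move=> cR Ruv uu'; pose D w := exists2 v', R w v' & same_component v v'.
apply: (proj1 (component_invariant (D := D) _ uu')); last by exists v => //; exact: component_refl.
move=> i w w' fw; split=> -[v' Rv' vv'].
  have := corr_f cR i Rv'; rewrite fw; case fv: (f i v') => [v''|] //= Rv''.
  by exists v'' => //; exact: component_trans vv' (component_f fv).
have := corr_e cR i Rv'; rewrite (f_e fw); case ev: (e i v') => [v''|] //= Rv''.
by exists v'' => //; exact: component_trans vv' (component_e ev).
Qed.

Lemma crystal_eqE u v : crystal_eq u v <-> sim u v.
Proof.
split=> [[psi [Bpsi psi_inj _ psi_ef] psi_u]|[m [n [R [cR Ruv]]]]].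
  exists (size u), (size v), (fun w z => B u w /\ psi w = z).
  split; last by split=> //; exact: component_refl.
  split.
  - by move=> w z [Bw <-]; rewrite (component_size Bw) (component_size (Bpsi _ Bw)).
  - by move=> w z z' [_ <-] [_ <-].
  - by move=> w w' z [Bw wz] [Bw' w'z]; apply: psi_inj; rewrite // wz.
  - move=> i w z [Bw <-]; have [-> _] := psi_ef i w Bw.
    case ew: (e i w) => [w'|] //=; split=> //.
    exact: component_trans Bw (component_e ew).
  - move=> i w z [Bw <-]; have [_ ->] := psi_ef i w Bw.
    case fw: (f i w) => [w'|] //=; split=> //.
    exact: component_trans Bw (component_f fw).
(* Outside the domain of [R] this value is arbitrary; only words of [B u] matter. *)
pose psi w : word := epsilon (inhabits ([::] : word)) (R w).
have psiP w : B u w -> R w (psi w).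
  move=> Bw; have [z Rwz _] := corr_component cR Ruv Bw.
  by apply: epsilon_spec; exists z.
have psiE w z : R w z -> psi w = z.
  move=> Rwz; have Rpsi : R w (psi w) by apply: epsilon_spec; exists z.
  exact: (corr_fun cR Rpsi Rwz).
exists psi; last exact: psiE.
split.
- by move=> w Bw; have [z /psiE <-] := corr_component cR Ruv Bw.
- move=> w w' /psiP Rw /psiP + E; rewrite -E; exact: (corr_inj cR Rw).
- move=> z Bz; have [w Rw Bw] := corr_component (corr_sym cR) Ruv Bz.
  by exists w => //; exact: psiE.
- move=> i w /psiP Rw; split.
    have := corr_e cR i Rw.
    by case: (e i w) => [w'|]; case: (e i (psi w)) => [z|] //= /psiE ->.
  have := corr_f cR i Rw.
  by case: (f i w) => [w'|]; case: (f i (psi w)) => [z|] //= /psiE ->.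
Qed.

(** * Isomorphisms of finite crystals, checked by computation *)

Definition pair_rel (s : seq (word * word)) (u v : word) : Prop := (u, v) \in s.

Definition opt_relb (s : seq (word * word)) (o o' : option word) : bool :=
  match o, o' with
  | Some u, Some v => (u, v) \in s
  | None, None => true
  | _, _ => false
  end.

Definition corrb (m n : nat) (s : seq (word * word)) : bool :=
  [&& uniq (unzip1 s), uniq (unzip2 s)
    & all (fun p => [&& size p.1 == m, size p.2 == n,
             opt_relb s (e c1 p.1) (e c1 p.2), opt_relb s (e c2 p.1) (e c2 p.2),
             opt_relb s (f c1 p.1) (f c1 p.2) & opt_relb s (f c2 p.1) (f c2 p.2)]) s].

Lemma opt_relbP s o o' : opt_relb s o o' -> opt_rel (pair_rel s) o o'.
Proof. by case: o; case: o'. Qed.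

Lemma uniq_map_inj (T1 T2 : eqType) (g : T1 -> T2) (s : seq T1) :
  uniq (map g s) -> {in s &, injective g}.
Proof.
elim: s => //= r s IHs /andP [nr /IHs {}IHs] x y.
rewrite !inE => /predU1P [->|xs] /predU1P [->|ys] // E; last exact: IHs.
  by case/negP: nr; rewrite E; apply: map_f.
by case/negP: nr; rewrite -E; apply: map_f.
Qed.

Lemma corrbP m n s : corrb m n s -> crystal_corr m n (pair_rel s).
Proof.
case/and3P=> us1 us2 /allP cs; split.
- by move=> u v /cs /and3P [/eqP -> /eqP ->].
- by move=> u v v' uv uv'; case: (uniq_map_inj us1 uv uv' erefl).
- by move=> u u' v uv uv'; case: (uniq_map_inj us2 uv uv' erefl).
- by move=> i u v /cs /and5P [_ _ h1 h2 _]; apply: opt_relbP; case: i.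
- by move=> i u v /cs /and5P [_ _ _ _ /andP [h1 h2]]; apply: opt_relbP; case: i.
Qed.

(** A pair with an arrow on one side only contributes nothing here; [corrb] then rejects it. *)
Definition f_pair (i : color) (p : word * word) : seq (word * word) :=
  if (f i p.1, f i p.2) is (Some u, Some v) then [:: (u, v)] else [::].

Definition orbit_pairs (k : nat) (u v : word) : seq (word * word) :=
  iter k (fun s => undup (s ++ flatten [seq f_pair c1 p ++ f_pair c2 p | p <- s]))
    [:: (u, v)].

(* [k] need only be at least the depth of the component, for the check to succeed. *)
Lemma sim_orbit k u v :
    (let s := orbit_pairs k u v in
     corrb (size u) (size v) s && ((u, v) \in s)) ->
  sim u v.
Proof. by case/andP=> /corrbP cR uv; exists (size u), (size v), (pair_rel (orbit_pairs k u v)). Qed.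

(** In this and the next five relations the bound 20 is safe: each [f] raises the total rank by 1,
    and a word of at most three letters has total rank at most 18. *)
Lemma sim_121 : sim [:: L1; L2; L1] [:: L1; L1; L2].
Proof. by apply: (@sim_orbit 20); vm_compute. Qed.

Lemma sim_123 : sim [:: L1; L2; L3] [:: L1; L1].
Proof. by apply: (@sim_orbit 20); vm_compute. Qed.

Lemma sim_10 : sim [:: L1; L0] [:: L1].
Proof. by apply: (@sim_orbit 20); vm_compute. Qed.

Lemma sim_113b : sim [:: L1; L1; L3b] [:: L1; L2].
Proof. by apply: (@sim_orbit 20); vm_compute. Qed.

Lemma sim_122b : sim [:: L1; L2; L2b] [:: L1].
Proof. by apply: (@sim_orbit 20); vm_compute. Qed.

Lemma sim_11b : sim [:: L1; L1b] [::].
Proof. by apply: (@sim_orbit 20); vm_compute. Qed.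

(** * Highest weight words and their normal form *)

Definition hw (u : word) : Prop := forall i, eps i u = 0.

Definition hw_word (a b : nat) : word :=
  nseq a L1 ++ flatten (nseq b [:: L1; L2]).

Lemma hw_rcons u x : hw (rcons u x) <-> hw u /\ forall i, eps1 i x <= phi i u.
Proof.
have eps_rcons i : eps i (rcons u x) = eps i u + (eps1 i x - phi i u).
  by rewrite -cats1 eps_cat eps_cons [eps i [::]]/eps /= addn0.
split=> [hu|[hu ux] i]; last by have := hu i; have := ux i; rewrite eps_rcons; lia.
by split=> i; have := hu i; rewrite eps_rcons; lia.
Qed.

(** Additivity of the weight, whose coordinates are [phi - eps], written without subtraction. *)
Lemma phi_rcons i u x :
  eps1 i x <= phi i u -> phi i (rcons u x) + eps1 i x = phi i u + phi1 i x.
Proof.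
rewrite -cats1 phi_cat phi_cons eps_cons.
have -> : eps i [::] = 0 by [].
have -> : phi i [::] = 0 by [].
lia.
Qed.

Lemma hw_word_phi a b :
  phi c1 (hw_word a b) = a /\ phi c2 (hw_word a b) = b.
Proof.
have ones i : phi i (nseq a L1) = phi1 i L1 * a.
  elim: a => [|a IHa]; first by rewrite muln0.
  rewrite -[nseq _ _]/(L1 :: nseq a L1) phi_cons IHa.
  have -> : eps i (nseq a L1) = 0.
    by elim: (a) => // k IHk; rewrite -[nseq _ _]/(L1 :: nseq k L1) eps_cons IHk; case: (i).
  by rewrite mulnS; lia.
have twos : [/\ eps c1 (flatten (nseq b [:: L1; L2])) = 0,
    eps c2 (flatten (nseq b [:: L1; L2])) = 0,
    phi c1 (flatten (nseq b [:: L1; L2])) = 0 &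
    phi c2 (flatten (nseq b [:: L1; L2])) = b].
  elim: b => [|b [e1b e2b p1b p2b]]; first by split.
  rewrite -[flatten _]/(L1 :: L2 :: flatten (nseq b [:: L1; L2])).
  by split; rewrite !(phi_cons, eps_cons) ?e1b ?e2b ?p1b ?p2b /phi1 /eps1 /=; lia.
case: twos => e1b e2b p1b p2b.
by rewrite /hw_word !phi_cat !ones e1b e2b p1b p2b; split; rewrite /phi1 /=; lia.
Qed.

(** Each use of 121 ~ 112 moves the final 1 to the left of one block 12. *)
Lemma sim_twos_one b :
  sim (flatten (nseq b [:: L1; L2]) ++ [:: L1]) (L1 :: flatten (nseq b [:: L1; L2])).
Proof.
elim: b => [|b IHb]; first exact: sim_refl.
apply: (@sim_trans ([:: L1; L2] ++ L1 :: flatten (nseq b [:: L1; L2]))).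
  exact: (sim_cat (sim_refl [:: L1; L2]) IHb).
exact: (sim_cat sim_121 (sim_refl (flatten (nseq b [:: L1; L2])))).
Qed.

Lemma sim_twos_ones a b :
  sim (flatten (nseq b [:: L1; L2]) ++ nseq a L1) (hw_word a b).
Proof.
elim: a => [|a IHa]; first by rewrite cats0; exact: sim_refl.
apply: (@sim_trans ((L1 :: flatten (nseq b [:: L1; L2])) ++ nseq a L1)).
  rewrite -[nseq a.+1 L1]/([:: L1] ++ nseq a L1) catA.
  exact: sim_cat (sim_twos_one b) (sim_refl _).
exact: (sim_cat (sim_refl [:: L1]) IHa).
Qed.

Lemma hw_word_addr a k b :
  sim (hw_word (a + k) b) (hw_word a b ++ nseq k L1).
Proof.
rewrite /hw_word nseqD -!catA.
exact: sim_cat (sim_refl _) (sim_sym (sim_twos_ones k b)).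
Qed.

Lemma nseq_flattenD b k (s : word) :
  flatten (nseq (b + k) s) = flatten (nseq b s) ++ flatten (nseq k s).
Proof. by rewrite nseqD flatten_cat. Qed.

(* Moving the 1s past the 12s brings [k] of them next to [x]. *)
Lemma hw_word_ones a k b x v : sim (nseq k L1 ++ [:: x]) v ->
  sim (rcons (hw_word (a + k) b) x) (hw_word a b ++ v).
Proof.
move=> xv; rewrite -cats1.
apply: (@sim_trans (hw_word a b ++ nseq k L1 ++ [:: x])); last first.
  exact: sim_cat (sim_refl _) xv.
by rewrite catA; apply: sim_cat (hw_word_addr a k b) (sim_refl _).
Qed.

(** The last block 12 and [x] turn into [k] ones, which then move left past the other blocks. *)
Lemma hw_word_twos a b x k : sim [:: L1; L2; x] (nseq k L1) ->
  sim (rcons (hw_word a b.+1) x) (hw_word (a + k) b).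
Proof.
move=> xv; rewrite -cats1 /hw_word -addn1 nseq_flattenD -!catA.
apply: sim_trans (sim_sym (hw_word_addr a k b)).
rewrite /hw_word -catA.
by apply: sim_cat (sim_refl _) (sim_cat (sim_refl _) xv).
Qed.

Lemma sim_hw_word u : hw u -> exists a b, sim u (hw_word a b).
Proof.
elim/last_ind: u => [|u x IHu]; first by exists 0, 0; exact: sim_refl.
case/hw_rcons=> /IHu [a [b ub]] ux.
have [p1 p2] := hw_word_phi a b.
have := ux c1; have := ux c2.
rewrite !(sim_phi _ ub) p1 p2 => x2 x1.
have uxb : sim (rcons u x) (rcons (hw_word a b) x).
  by rewrite -!cats1; exact: sim_cat ub (sim_refl _).
suff [a' [b' ab']] : exists a' b', sim (rcons (hw_word a b) x) (hw_word a' b').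
  by exists a', b'; exact: sim_trans uxb ab'.
(* The bounds on [a] and [b] supply the letters that each relation consumes in front of [x]; for 2,
   a block 12 is merely regrouped. *)
case: x x1 x2 {ux uxb} => [_ _|a1 _|_ b1|a1 _|a2 _|_ b1|a1 _].
- exists a.+1, b; rewrite -addn1; apply: sim_sym; rewrite -cats1; exact: hw_word_addr.
- case: a a1 {ub p1 p2} => // a _; exists a, b.+1.
  rewrite -addn1 -[b.+1]addn1 /hw_word nseq_flattenD catA.
  exact: (@hw_word_ones _ 1 _ _ _ (sim_refl _)).
- case: b b1 {ub p1 p2} => // b _; exists (a + 2), b.
  exact: (@hw_word_twos _ _ _ 2 sim_123).
- case: a a1 {ub p1 p2} => // a _; exists a.+1, b; rewrite -addn1.
  apply: sim_trans (sim_sym (hw_word_addr a 1 b)).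
  exact: (@hw_word_ones _ 1 _ _ _ sim_10).
- case: a a2 {ub p1 p2} => [|[|a]] // _; exists a, b.+1; rewrite -[a.+2]addn2.
  rewrite -[b.+1]addn1 /hw_word nseq_flattenD catA.
  exact: (@hw_word_ones _ 2 _ _ _ sim_113b).
- case: b b1 {ub p1 p2} => // b _; exists (a + 1), b.
  exact: (@hw_word_twos _ _ _ 1 sim_122b).
case: a a1 {ub p1 p2} => // a _; exists a, b; rewrite -addn1 -[hw_word a b]cats0.
exact: (@hw_word_ones _ 1 _ _ _ sim_11b).
Qed.

Lemma hw_None u : hw u <-> forall i, e i u = None.
Proof. by split=> h i; apply/e_None/h. Qed.

Lemma component_hw u : exists2 v, same_component u v & hw v.
Proof.
have [n] := ubnP (total_rank u); elim: n => // n IHn in u *; move=> un.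
have step i v : e i u = Some v -> exists2 v', same_component u v' & hw v'.
  move=> eu; have [|v' vv' hv'] := IHn v; first by rewrite -ltnS -(e_total_rank eu).
  by exists v' => //; exact: component_trans (component_e eu) vv'.
case eu1: (e c1 u) => [v|]; first exact: step eu1.
case eu2: (e c2 u) => [v|]; first exact: step eu2.
by exists u; [exact: component_refl | apply/hw_None; case].
Qed.

(** * Stability of tableaux under the crystal operators *)

Definition letters : seq letter := [:: L1; L2; L3; L0; L3b; L2b; L1b].

(** All 56 fillings, admissible or not, so that evaluation decides statements about every column. *)
Definition columns : seq column :=
  map Box1 letters ++ [seq Box2 a b | a <- letters, b <- letters].

Lemma columnsP (p : column -> bool) : all p columns -> forall C, p C.
Proof.
move=> pc C; have lettersP a : a \in letters by case: a.
case: C => [a|a b]; move: pc; rewrite /columns all_cat => /andP [].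
  by rewrite all_map => /allP /(_ a (lettersP a)).
by move=> _ /all_allpairsP; apply.
Qed.

Definition column_of (u : word) : option column :=
  match u with
  | [:: a] => Some (Box1 a)
  | [:: a; b] => Some (Box2 a b)
  | _ => None
  end.

(* When an operator acts on the column [C] of a tableau, the signature rule
   bounds [phi] of the column right of [C] and [eps] of the column left of [C];
   these bounds are what makes [C'] fit between its neighbours. *)
Definition fits (i : color) (p q : nat) (C C' : column) : bool :=
  [&& admissible C', height C' == height C,
      all (fun D => [&& admissible D, leC C D & phi i (read_column D) <= p] ==> leC C' D) columns
    & all (fun D => [&& admissible D, leC D C & eps i (read_column D) <= q] ==> leC D C') columns].

(* [k] is 0 for [f] and 1 for [e]: it tells which of the two bounds of the
   signature rule is strict. *)
Definition step_ok (g : color -> word -> option word) (k : nat) (i : color) (C : column) : bool :=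
  admissible C ==>
  if g i (read_column C) is Some u then
    if column_of u is Some C' then
      (read_column C' == u) &&
      fits i (eps i (read_column C) - k) (phi i (read_column C) - (1 - k)) C C'
    else false
  else true.

Lemma f_step_ok i C : step_ok f 0 i C.
Proof. by move: C; apply: columnsP; case: i; vm_compute. Qed.

Lemma e_step_ok i C : step_ok e 1 i C.
Proof. by move: C; apply: columnsP; case: i; vm_compute. Qed.

Lemma reading_cons C T : reading (C :: T) = reading T ++ read_column C.
Proof. by rewrite /reading rev_cons map_rcons flatten_rcons. Qed.

Lemma reading_cat S T : reading (S ++ T) = reading T ++ reading S.
Proof. by rewrite /reading rev_cat map_cat flatten_cat. Qed.

(** Readings run from the last column to the first, so [T2] stands left of [C] in the tensor product
    and [T1] right of it. *)
Lemma f_reading i T w : f i (reading T) = Some w ->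
  exists T1 C T2 u, [/\ T = T1 ++ C :: T2, f i (read_column C) = Some u,
    w = reading T2 ++ u ++ reading T1, phi i (reading T2) <= eps i (read_column C)
    & eps i (reading T1) < phi i (read_column C)].
Proof.
elim: T w => [|D T IHT] w //; rewrite reading_cons f_cat; case: ltnP => DT.
  case fT: (f i (reading T)) => [v|] //= [<-].
  have [T1 [C [T2 [u [ET fC -> T2C CT1]]]]] := IHT _ fT.
  exists (D :: T1), C, T2, u; rewrite ET reading_cons -!catA; split=> //.
  move: DT; rewrite ET reading_cat reading_cons eps_cat !phi_cat; lia.
case fD: (f i (read_column D)) => [u|] //= [<-].
exists [::], D, T, u; rewrite cats0; split=> //.
by rewrite phi_rec fD.
Qed.

Lemma e_reading i T w : e i (reading T) = Some w ->
  exists T1 C T2 u, [/\ T = T1 ++ C :: T2, e i (read_column C) = Some u,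
    w = reading T2 ++ u ++ reading T1, phi i (reading T2) < eps i (read_column C)
    & eps i (reading T1) <= phi i (read_column C)].
Proof.
elim: T w => [|D T IHT] w //; rewrite reading_cons e_cat; case: ltnP => DT.
  case eD: (e i (read_column D)) => [u|] //= [<-].
  by exists [::], D, T, u; rewrite cats0; split.
case eT: (e i (reading T)) => [v|] //= [<-].
have [T1 [C [T2 [u [ET eC -> T2C CT1]]]]] := IHT _ eT.
exists (D :: T1), C, T2, u; rewrite ET reading_cons -!catA; split=> //.
move: DT; rewrite ET reading_cat reading_cons eps_cat !phi_cat; lia.
Qed.

(** The right neighbour of [C] is the last factor of [reading T2], so its [phi] is at most that of
    [T2]; the left neighbour is the first factor of [reading T1], so the same holds for [eps]. *)
Lemma fits_tableau i p q l1 l2 T1 C T2 C' :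
    tableau_of l1 l2 (T1 ++ C :: T2) -> fits i p q C C' ->
    phi i (reading T2) <= p -> eps i (reading T1) <= q ->
  tableau_of l1 l2 (T1 ++ C' :: T2).
Proof.
case=> sT; rewrite all_cat /= => /and3P [aT1 aC aT2] sortT.
case/and4P=> aC' /eqP hC' /columnsP right_ok /columnsP left_ok p2 q1.
split; first by rewrite -sT /shape !map_cat /= hC'.
  by rewrite all_cat /= aT1 aC'.
have sort2 : sorted leC (C' :: T2).
  have : sorted leC (C :: T2) by move: sortT; rewrite sorted_cat_cons; case/andP.
  case: T2 sT aT2 {sortT} p2 => [|D T2] //= _ /andP [aD _] p2 /andP [CD ->].
  rewrite andbT; apply: (implyP (right_ok D)); rewrite aD CD (leq_trans _ p2) //.
  by rewrite reading_cons phi_cat leq_addr.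
rewrite sorted_cat_cons [path _ _ _]sort2 andbT.
move: sortT; rewrite sorted_cat_cons => /andP [sort1 _].
case/lastP: T1 {sT} aT1 sort1 q1 => [|T1 D] //; rewrite all_rcons => /andP [aD _].
rewrite -[rcons _ C]cats1 -[rcons _ C']cats1 !cat_rcons !sorted_cat_cons /= !andbT.
case/andP=> -> DC q1; apply: (implyP (left_ok D)); rewrite aD DC (leq_trans _ q1) //.
by rewrite -cats1 reading_cat eps_cat reading_cons /= leq_addr.
Qed.

Lemma step_okP g k i C u : step_ok g k i C -> admissible C ->
    g i (read_column C) = Some u ->
  exists2 C', u = read_column C' &
    fits i (eps i (read_column C) - k) (phi i (read_column C) - (1 - k)) C C'.
Proof.
move=> /implyP/[apply] /[swap] ->.
by case: column_of => // C' /andP [/eqP <- fC]; exists C'.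
Qed.

Lemma tableau_f i l1 l2 T w : tableau_of l1 l2 T -> f i (reading T) = Some w ->
  exists2 T', tableau_of l1 l2 T' & w = reading T'.
Proof.
move=> tT /f_reading [T1 [C [T2 [u [ET fC -> T2C CT1]]]]].
have aC : admissible C by case: tT => _; rewrite ET all_cat /= => /and3P [].
have [C' -> fitC] := step_okP (f_step_ok i C) aC fC.
rewrite ET in tT; exists (T1 ++ C' :: T2); last by rewrite reading_cat reading_cons catA.
by apply: fits_tableau tT fitC _ _; lia.
Qed.

Lemma tableau_e i l1 l2 T w : tableau_of l1 l2 T -> e i (reading T) = Some w ->
  exists2 T', tableau_of l1 l2 T' & w = reading T'.
Proof.
move=> tT /e_reading [T1 [C [T2 [u [ET eC -> T2C CT1]]]]].
have aC : admissible C by case: tT => _; rewrite ET all_cat /= => /and3P [].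
have [C' -> fitC] := step_okP (e_step_ok i C) aC eC.
rewrite ET in tT; exists (T1 ++ C' :: T2); last by rewrite reading_cat reading_cons catA.
by apply: fits_tableau tT fitC _ _; lia.
Qed.

(** * Highest weight tableaux *)

Definition hw_tableau (a b : nat) : seq column :=
  nseq b (Box2 L1 L2) ++ nseq a (Box1 L1).

Lemma hw_tableau_of a b : tableau_of a b (hw_tableau a b).
Proof.
split; first by rewrite /shape map_cat !map_nseq.
  by rewrite all_cat !all_nseq /= !orbT.
have ones : sorted leC (nseq a (Box1 L1)).
  by case: a => // a; elim: a.
rewrite /hw_tableau; case: b => // b; elim: b => [|b IHb] //=.
by case: a ones.
Qed.

Lemma reading_hw_tableau a b : reading (hw_tableau a b) = hw_word a b.
Proof.
rewrite reading_cat /reading !rev_nseq !map_nseq /hw_word; congr (_ ++ _).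
by elim: a => //= a ->.
Qed.

Definition hw_column (C : column) : bool :=
  match C with Box1 L1 | Box2 L1 L2 => true | _ => false end.

Lemma hw_columnP C : hw_column C -> C = Box1 L1 \/ C = Box2 L1 L2.
Proof. by case: C => [[]|[] []] //; [left|right]. Qed.

(** For a new column left of single boxes 1: their reading has [phi c2] equal to 0, which forces
    [eps c2] of the column to vanish. *)
Lemma hw_column_left_1 C :
  [&& admissible C, leC C (Box1 L1) & eps c2 (read_column C) == 0] ==> hw_column C.
Proof. by move: C; apply: columnsP; vm_compute. Qed.

Lemma hw_column_left_12 C :
  admissible C && leC C (Box2 L1 L2) ==> hw_column C && (height C == 2).
Proof. by move: C; apply: columnsP; vm_compute. Qed.

Lemma hw_column_last C :
  [&& admissible C, eps c1 (read_column C) == 0 & eps c2 (read_column C) == 0]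
  ==> hw_column C.
Proof. by move: C; apply: columnsP; vm_compute. Qed.

Lemma hw_cat u v : hw (u ++ v) -> hw u /\ forall i, eps i v <= phi i u.
Proof. by move=> huv; split=> i; have := huv i; rewrite eps_cat; lia. Qed.

(** Removing the first column leaves a prefix of the reading, again of highest weight; induction
    fixes the rest, and the order and [eps] conditions fix the column. *)
Lemma hw_tableau_unique T : all admissible T -> sorted leC T -> hw (reading T) ->
  exists a b, T = hw_tableau a b.
Proof.
elim: T => [|C T IHT]; first by exists 0, 0.
move=> /andP [aC aT] CT; rewrite reading_cons => /hw_cat [hT TC].
have sT : sorted leC T by case: T CT {IHT aT hT TC} => //= D T /andP [].
have [a [b ET]] := IHT aT sT hT.
have [p1 p2] := hw_word_phi a b.
have C1 := TC c1; have C2 := TC c2.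
move: C1 C2; rewrite ET reading_hw_tableau p1 p2 => C1 C2.
have CT' : sorted leC (C :: hw_tableau a b) by rewrite -ET.
clear CT p1 p2 hT TC IHT sT aT ET.
case: b C2 CT' => [|b] C2 CT'.
  have /hw_columnP [->|->] : hw_column C; [|by exists a.+1, 0|by exists a, 1].
  case: a C1 CT' => [|a] C1 CT'.
    by apply: (implyP (hw_column_last C)); rewrite aC -!leqn0 C1.
  apply: (implyP (hw_column_left_1 C)); rewrite aC -!leqn0 C2 andbT.
  by case/andP: CT'.
have /andP [/hw_columnP [->|->] //] : hw_column C && (height C == 2).
  by apply: (implyP (hw_column_left_12 C)); rewrite aC; case/andP: CT'.
by exists a, b.+2.
Qed.

Lemma Y_inj a b a' b' : Y a b = Y a' b' -> a = a' /\ b = b'.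
Proof.
move=> /(congr1 (fun s => (count_mem 1 s, count_mem 2 s))).
by rewrite /Y !count_cat !count_nseq /= !mul0n !mul1n !addn0 add0n => -[-> ->].
Qed.

Lemma tableau_hw a b T : tableau_of a b T -> hw (reading T) ->
  reading T = hw_word a b.
Proof.
case=> sT aT oT hT; have [a' [b' ET]] := hw_tableau_unique aT oT hT.
have [sT' _ _] := hw_tableau_of a' b'.
move: sT; rewrite ET sT' => /Y_inj [<- <-]; exact: reading_hw_tableau.
Qed.

(** * The highest weight word of a component and the shape of its tableau *)

Lemma corr_tableau m n R u v a b T :
    crystal_corr m n R -> R u (reading T) -> tableau_of a b T ->
    same_component u v ->
  exists2 T', tableau_of a b T' & R v (reading T').
Proof.
move=> cR RuT tT uv; pose D w := exists2 T', tableau_of a b T' & R w (reading T').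
apply: (proj1 (component_invariant (D := D) _ uv)); last by exists T.
move=> i w w' fw; split=> -[T' tT' RT'].
  have := corr_f cR i RT'; rewrite fw; case fT: (f i _) => [z|] //=.
  by have [T'' tT'' ->] := tableau_f tT' fT; exists T''.
have := corr_e cR i RT'; rewrite (f_e fw); case eT: (e i _) => [z|] //=.
by have [T'' tT'' ->] := tableau_e tT' eT; exists T''.
Qed.

Lemma sim_hw u v : sim u v -> hw u -> hw v.
Proof. by move=> uv hu i; rewrite -(sim_eps i uv). Qed.

Lemma corr_hw_word m n R u v a b T :
    crystal_corr m n R -> R u (reading T) -> tableau_of a b T ->
    same_component u v -> hw v ->
  R v (hw_word a b).
Proof.
move=> cR RuT tT uv hv; have [T' tT' RvT'] := corr_tableau cR RuT tT uv.
rewrite -(tableau_hw tT') //; apply: sim_hw hv.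
by exists m, n, R.
Qed.

(** Existence of the tableau: it is found at the highest weight vertex and carried back along the
    arrows to [u]. *)
Lemma component_tableau u : exists a b T, tableau_of a b T /\ sim u (reading T).
Proof.
have [v uv hv] := component_hw u; have [a [b [m [n [R [cR Rv]]]]]] := sim_hw_word hv.
rewrite -reading_hw_tableau in Rv.
have [T tT RuT] := corr_tableau cR Rv (hw_tableau_of a b) (component_sym uv).
by exists a, b, T; split=> //; exists m, n, R.
Qed.

(** Both words correspond to the same [hw_word a b], and a correspondence is injective. *)
Lemma component_hw_unique u v : same_component u v -> hw u -> hw v -> u = v.
Proof.
move=> uv hu hv; have [a [b [T [tT [m [n [R [cR RuT]]]]]]]] := component_tableau u.
have Ru := corr_hw_word cR RuT tT (component_refl u) hu.
exact: (corr_inj cR Ru (corr_hw_word cR RuT tT uv hv)).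
Qed.

(** Whichever tableau [epsilon] picks, [v] corresponds to the highest weight word of its shape,
    whose [phi] values are the shape parameters. *)
Lemma shape_P u v : same_component u v -> hw v ->
  shape (P u) = Y (phi c1 v) (phi c2 v).
Proof.
move=> uv hv.
have [[a [b tP]] /crystal_eqE [m [n [R [cR RuP]]]]] :
    is_tableau (P u) /\ crystal_eq u (reading (P u)).
  apply: (epsilon_spec (inhabits [::])
    (fun T => is_tableau T /\ crystal_eq u (reading T))).
  have [a [b [T [tT uT]]]] := component_tableau u.
  by exists T; split; [exists a, b | apply/crystal_eqE].
have Rv := corr_hw_word cR RuP tP uv hv.
have [p1 p2] := hw_word_phi a b.
by rewrite (corr_phi c1 cR Rv) (corr_phi c2 cR Rv) p1 p2; case: tP.
Qed.

(** * Prefixes and the recording sequence *)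

(** By the tensor rule an arrow changes either the prefix, by an arrow of the same color, or only
    the rest. *)
Lemma component_take k u v :
  same_component u v -> same_component (take k u) (take k v).
Proof.
elim=> [w w' [i]||w w' _ IH|w w' w'' _ IH _ IH'];
  [|move=> w; exact: component_refl|exact: component_sym|exact: component_trans IH IH'].
rewrite -{1}(cat_take_drop k w) f_cat; case: ifP => _.
  case fk: (f i (take k w)) => [z|] //= [<-]; apply: (component_f (i := i)).
  rewrite fk take_cat; have sz := f_size fk; rewrite sz size_take.
  case: (ltnP k (size w)) => kw.
    by rewrite ltnn subnn take0 cats0.
  rewrite ltnNge kw /= (drop_oversize kw).
  by rewrite cats0.
case fk: (f i (drop k w)) => [z|] //= [<-].
have -> : take k (take k w ++ z) = take k w; last exact: component_refl.
case: (ltnP k (size w)) => kw; first by rewrite take_size_cat // size_takel // ltnW.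
by move: fk; rewrite drop_oversize.
Qed.

Lemma Q_rcons u x : Q (rcons u x) = rcons (Q u) (shape (P (rcons u x))).
Proof.
rewrite /Q size_rcons -[(size u).+1]addn1 iotaD map_cat /= -[RHS]cats1 add1n; congr (_ ++ [:: _]).
  apply/eq_in_map => i; rewrite mem_iota => /andP [_ iu].
  by rewrite -cats1 takel_cat.
by rewrite take_oversize // size_rcons.
Qed.

(** The hypothesis is equality of weights, and the seven weights of the letters are distinct. *)
Lemma letter_weight_inj a b :
  (forall i, phi1 i a + eps1 i b = phi1 i b + eps1 i a) -> a = b.
Proof. by move=> h; move: (h c1) (h c2); case: a {h}; case: b. Qed.

Theorem theorem3p3p3 (w1 w2 : word) : same_component w1 w2 <-> Q w1 = Q w2.
Proof.
split=> [w12|].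
  rewrite /Q (component_size w12); apply: eq_map => k.
  (* Both prefixes lie in one component, whose highest weight word determines both shapes. *)
  have [v w1v hv] := component_hw (take k w1).
  rewrite (shape_P w1v hv) (shape_P _ hv) //.
  exact: component_trans (component_sym (component_take k w12)) w1v.
elim/last_ind: w1 w2 => [|w1 x1 IH] w2; case/lastP: w2 => [|w2 x2].
- by move=> _; exact: component_refl.
- by rewrite Q_rcons; case: (Q w2).
- by rewrite Q_rcons; case: (Q w1).
rewrite !Q_rcons => /rcons_inj [/IH w12].
(* The highest weight word of the component of [rcons w x] has a prefix in the component of [w], by
   truncation. *)
have prefix w x : exists v y, [/\ same_component (rcons w x) (rcons v y),
    same_component w v & hw (rcons v y)].
  have [u] := component_hw (rcons w x).
  case/lastP: u => [/component_size|v y wv hv]; first by rewrite size_rcons.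
  exists v, y; split=> //; have sv := component_size wv.
  move: (component_take (size w) wv); rewrite -!cats1 take_size_cat // take_size_cat //.
  by move: sv; rewrite !size_rcons => -[].
have [v1 [y1 [C1 D1 h1]]] := prefix w1 x1.
have [v2 [y2 [C2 D2 h2]]] := prefix w2 x2.
have [hv1 ph1] := proj1 (hw_rcons _ _) h1; have [hv2 ph2] := proj1 (hw_rcons _ _) h2.
(* By induction [w1] and [w2] share a component, and [v1], [v2] are highest weight words in it. *)
have Ev : v1 = v2.
  apply: component_hw_unique hv1 hv2.
  exact: component_trans (component_trans (component_sym D1) w12) D2.
subst v2; rewrite (shape_P C1 h1) (shape_P C2 h2) => /Y_inj [q1 q2].
suff Ey : y1 = y2 by subst y2; exact: component_trans C1 (component_sym C2).
apply: letter_weight_inj => i.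
(* Equal shapes give equal [phi]; cancelling the common [phi i v1] leaves the weights of the last
   letters. *)
have q : phi i (rcons v1 y1) = phi i (rcons v1 y2) by case: i.
by have := phi_rcons (ph1 i); have := phi_rcons (ph2 i); rewrite q; lia.
Qed.
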